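(* Let $L$ be either (i) a finite-dimensional classical simple Lie algebra with non-degenerate Killing form over a field $\mathbb{F}$ of characteristic not $2$ or $3$, or (ii) the Witt algebra $\mathcal{W}^+_n=\mathrm{Der}(\mathbb{F}[t_1,\ldots,t_n])$, $n\geq 1$, over a field $\mathbb{F}$ of characteristic $0$. Then every commutative post-Lie algebra structure on $L$ is trivial, i.e. its product satisfies $x\cdot y=0$ for all $x,y\in L$.
   Context: A commutative post-Lie algebra structure on a Lie algebra $L$ over a field $\mathbb{F}$ is an $\mathbb{F}$-bilinear product $L\times L\to L$, $(x,y)\mapsto x\cdot y$, satisfying for all $x,y,z\in L$: $x\cdot y=y\cdot x$; $[x,y]\cdot z=x\cdot(y\cdot z)-y\cdot(x\cdot z)$; and $x\cdot[y,z]=[x\cdot y,z]+[y,x\cdot z]$. Convention on classical simple Lie algebras: $\mathfrak{g}$ is simple and finite-dimensional over $\mathbb{F}$; with respect to a fixed Cartan subalgebra $\mathfrak{h}$ it has a root space decomposition $\mathfrak{g}=\mathfrak{h}\oplus\bigoplus_{\alpha\in\Phi}\mathfrak{g}_\alpha$, where $\Phi\subset\mathfrak{h}^*$ is the root system determined by $\mathfrak{h}$ and each root space $\mathfrak{g}_\alpha$ ($\alpha\in\Phi$) is one-dimensional; and, with $\Phi_+$ the set of positive roots and $\Pi$ the set of simple roots, $\mathfrak{g}$ has a Chevalley basis $\{e_\alpha,f_\alpha,h_\beta\mid\alpha\in\Phi_+,\beta\in\Pi\}$. $\mathcal{W}^+_n$ is the Lie algebra of $\mathbb{F}$-derivations of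 the polynomial algebra $A_n=\mathbb{F}[t_1,\ldots,t_n]$. With $d_i=\frac{\partial}{\partial t_i}$ we have $\mathcal{W}^+_n=\bigoplus_{i=1}^n A_n d_i$ and $[fd_i,gd_j]=fd_i(g)d_j-gd_j(f)d_i$ for $f,g\in A_n$. *)

(* Defs.v *)
From HB Require Import structures.
From mathcomp Require Import all_boot all_order all_algebra.
From mathcomp Require Import mpoly.
From mathcomp Require Import boolp functions.

Set Implicit Arguments.
Unset Strict Implicit.
Unset Printing Implicit Defensive.

Import Order.TTheory GRing.Theory Num.Theory.
Local Open Scope ring_scope.

Reserved Notation "\[ x , y \]" (at level 0, x, y at level 200,
  format "\[ x ,  y \]").

HB.mixin Record Lmodule_isLie (F : fieldType) L of GRing.Lmodule F L := {
  bracket : L -> L -> L;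
  bracket_linearl : forall y, linear (bracket^~ y);
  bracket_linearr : forall x, linear (bracket x);
  bracketxx : forall x, bracket x x = 0;
  bracket_jacobi : forall x y z,
    bracket x (bracket y z) + bracket y (bracket z x)
      + bracket z (bracket x y) = 0
}.

#[short(type="lieAlgType")]
HB.structure Definition LieAlgebra (F : fieldType) :=
  {L of Lmodule_isLie F L & GRing.Lmodule F L}.

#[short(type="finLieAlgType")]
HB.structure Definition FinLieAlgebra (F : fieldType) :=
  {L of Lmodule_isLie F L & Vector F L}.

Notation "\[ x , y \]" := (bracket x y) : ring_scope.

Record commutative_post_lie (F : fieldType) (L : lieAlgType F)
    (m : L -> L -> L) : Prop := CommutativePostLie {
  cpl_linearl : forall y, linear (m^~ y);
  cpl_linearr : forall x, linear (m x);
  cplC : forall x y, m x y = m y x;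
  cpl_bracketl : forall x y z, m \[x, y\] z = m x (m y z) - m y (m x z);
  cpl_bracketr : forall x y z, m x \[y, z\] = \[m x y, z\] + \[y, m x z\]
}.

Section FiniteDimensional.
Variables (F : fieldType) (L : finLieAlgType F).
Implicit Types (x y z : L) (U V H I : {vspace L}).

HB.instance Definition _ x := GRing.isLinear.Build F L L _
  (bracket x) (bracket_linearr x).

Definition ad x : 'End(L) := linfun (bracket x).

Lemma adE x y : ad x y = \[x, y\].
Proof. exact: lfunE. Qed.

Definition lfun_trace (f : 'End(L)) : F :=
  \tr (passmx.mxof (vbasis {:L}) (vbasis {:L}) f).

Definition killing x y : F := lfun_trace (ad x \o ad y)%VF.

Definition killing_nondegenerate : Prop :=
  forall x, (forall y, killing x y = 0) -> x = 0.

Definition lie_ideal I : Prop := forall x y, y \in I -> \[x, y\] \in I.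

Definition simple_lie : Prop :=
  (exists x y, \[x, y\] <> 0) /\
  (forall I, lie_ideal I -> I = 0%VS \/ I = {:L}%VS).

Definition lie_subalgebra H : Prop :=
  forall x y, x \in H -> y \in H -> \[x, y\] \in H.

Definition lie_prod U V : {vspace L} :=
  <<[seq \[x, y\] | x <- vbasis U, y <- vbasis V]>>%VS.

Definition lie_nilpotent H : Prop :=
  exists k, iter k (lie_prod H) H = 0%VS.

Definition lie_self_normalizing H : Prop :=
  forall x, (forall y, y \in H -> \[x, y\] \in H) -> x \in H.

Definition cartan_subalgebra H : Prop :=
  [/\ lie_subalgebra H, lie_nilpotent H & lie_self_normalizing H].

End FiniteDimensional.

Notation hdual F H := 'Hom(subvs_of H, (F : fieldType)^o).

Section Roots.
Variables (F : fieldType) (L : finLieAlgType F) (H : {vspace L}).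
Implicit Types (a : hdual F H) (Phi : seq (hdual F H)).

(* The condition [h, x] = a(h) x is imposed for h in a basis of H only;
   rootspaceP extends it to all of H. *)
Definition rootspace a : {vspace L} :=
  (\bigcap_(i < \dim {:subvs_of H})
     lker (ad (vsval (vbasis {:subvs_of H})`_i)
           - (a (vbasis {:subvs_of H})`_i : F) *: (\1%VF : 'End(L))))%VS.

Lemma rootspaceP a x :
  reflect (forall h : subvs_of H, \[vsval h, x\] = (a h : F) *: x)
          (x \in rootspace a).
Proof.
have mem_lker h : (x \in lker (ad (vsval h) - (a h : F) *: (\1%VF : 'End(L)))) =
    (\[vsval h, x\] == (a h : F) *: x).
  by rewrite memv_ker add_lfunE opp_lfunE scale_lfunE id_lfunE adE subr_eq0.
rewrite /rootspace memvE; apply: (iffP subv_bigcapP) => [xP h | xP i _].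
  pose f : L -> L := fun k => \[k, x\].
  have f_lin : linear f by exact: bracket_linearl.
  pose fL : {linear L -> L} := HB.pack f (GRing.isLinear.Build F L L _ f f_lin).
  rewrite -[LHS]/(fL (vsval h)) (coord_vbasis (memvf h)) !linear_sum scaler_suml.
  apply: eq_bigr => i _; rewrite !linearZ /= -scalerA; congr (_ *: _).
  by apply/eqP; rewrite -mem_lker memvE xP.
by rewrite -memvE mem_lker xP.
Qed.

Definition is_root a : Prop := a != 0 /\ rootspace a != 0%VS.

(* Phi enumerates the (finite) set of roots without repetition. *)
Record root_decomposition Phi : Prop := RootDecomposition {
  roots_uniq : uniq Phi;
  rootsP : forall a, a \in Phi <-> is_root a;
  roots_direct : directv (H + \sum_(i < size Phi) rootspace Phi`_i);
  roots_full : (H + \sum_(i < size Phi) rootspace Phi`_i)%VS = {:L}%VS;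
  roots_dim1 : forall a, a \in Phi -> \dim (rootspace a) = 1%N
}.

End Roots.

(* A reduced (crystallographic) root system together with a base. The root
   lattice is identified with Z^l by the base, so that the simple roots are the
   standard basis vectors; av a is the coroot of a, as a linear form on Z^l, and
   integrality of the Cartan integers is built into the types. Over a field of
   positive characteristic, positivity only makes sense at this level and not
   for the roots as elements of the dual of a Cartan subalgebra. *)
Section RootSystem.
Variable l : nat.
Implicit Types (a b : 'rV[int]_l) (R : seq 'rV[int]_l).

Definition simple_root (i : 'I_l) : 'rV[int]_l := delta_mx 0 i.

Definition positive_root R a : Prop := a \in R /\ forall i, 0 <= a 0 i.

Definition pairing a (c : 'cV[int]_l) : int := (a *m c) 0 0.

Record based_root_system R (av : 'rV[int]_l -> 'cV[int]_l) : Prop :=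
    BasedRootSystem {
  rs_uniq : uniq R;
  rs_neq0 : 0 \notin R;
  rs_simple : forall i, simple_root i \in R;
  rs_signed : forall a, a \in R -> positive_root R a \/ positive_root R (- a);
  rs_coroot : forall a, a \in R -> pairing a (av a) = 2;
  rs_reflection : forall a b, a \in R -> b \in R ->
    b - pairing b (av a) *: a \in R;
  rs_reduced : forall a b (p q : int), a \in R -> b \in R ->
    p != 0 -> p *: b = q *: a -> b = a \/ b = - a
}.

End RootSystem.

Section Chevalley.
Variables (F : fieldType) (L : finLieAlgType F) (H : {vspace L}).
Variable Phi : seq (hdual F H).
Variables (l : nat) (R : seq 'rV[int]_l) (av : 'rV[int]_l -> 'cV[int]_l).

(* rt realizes the abstract root system R as the set Phi of roots in the dual
   of H. The vector f_a is e (- a). *)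
Record chevalley_basis (rt : {additive 'rV[int]_l -> hdual F H})
    (e : 'rV[int]_l -> L) (h : 'I_l -> L) : Prop := ChevalleyBasis {
  chev_roots : perm_eq [seq rt a | a <- R] Phi;
  chev_basis : basis_of {:L}%VS ([seq e a | a <- R] ++ [seq h i | i : 'I_l]);
  chev_cartan : forall i, h i \in H;
  chev_rootvec : forall a, a \in R -> e a \in rootspace (rt a);
  chev_hh : forall i j, \[h i, h j\] = 0;
  chev_he : forall i a, a \in R ->
    \[h i, e a\] = (pairing a (av (simple_root i)))%:~R *: e a;
  (* [e_a, f_a] is h_a, the integral combination of the h_i given by the
     expansion of the coroot of a in terms of the simple coroots *)
  chev_ef : forall a, a \in R -> exists2 c : 'I_l -> int,
    av a = \sum_i c i *: av (simple_root i) &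
    \[e a, e (- a)\] = \sum_i h i *~ c i;
  (* r is the largest integer such that b - r a, ..., b are all roots *)
  chev_ee : forall a b, a \in R -> b \in R -> a + b \in R ->
    exists r : nat, [/\ forall k, (k <= r)%N -> b - a *+ k \in R,
      b - a *+ r.+1 \notin R &
      \[e a, e b\] = r.+1%:R *: e (a + b) \/
      \[e a, e b\] = - (r.+1%:R *: e (a + b))];
  chev_ee0 : forall a b, a \in R -> b \in R -> a + b != 0 ->
    a + b \notin R -> \[e a, e b\] = 0
}.

End Chevalley.

Definition classical_simple (F : fieldType) (L : finLieAlgType F) : Prop :=
  simple_lie L /\
  exists (H : {vspace L}) (Phi : seq (hdual F H)),
    [/\ cartan_subalgebra H, root_decomposition Phi &
      exists (l : nat) (R : seq 'rV[int]_l) (av : 'rV[int]_l -> 'cV[int]_l)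
             (rt : {additive 'rV[int]_l -> hdual F H})
             (e : 'rV[int]_l -> L) (h : 'I_l -> L),
        based_root_system R av /\ chevalley_basis Phi R av rt e h].

Section Derivations.
Variables (F : fieldType) (A : algType F).

Definition is_derivation (D : A -> A) : Prop :=
  linear D /\ forall a b, D (a * b) = D a * b + a * D b.

Definition derivations : {pred (A -> A)} := [pred D | `[< is_derivation D >]].

Lemma derivations_submod_closed : submod_closed derivations.
Proof.
split; first by apply/asboolP; split=> [k a b|a b] /=;
  rewrite /GRing.zero /= ?scaler0 ?mul0r ?mulr0 addr0.
move=> k D E /asboolP[Dl DM] /asboolP[El EM]; apply/asboolP.
split=> [c a b|a b] /=; rewrite !fctE ?Dl ?El ?DM ?EM.
  by rewrite !scalerDr !scalerA [k * c]mulrC addrACA.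
by rewrite mulrDl mulrDr scalerDr -!scalerAl -!scalerAr addrACA.
Qed.

HB.instance Definition _ :=
  GRing.isSubmodClosed.Build F (A -> A) derivations derivations_submod_closed.

Record Der := MkDer { der_fun :> A -> A; _ : der_fun \in derivations }.

HB.instance Definition _ := [isSub for der_fun].
HB.instance Definition _ := [Choice of Der by <:].
HB.instance Definition _ := [SubChoice_isSubLmodule of Der by <:].

Lemma derP (D : Der) : is_derivation D.
Proof. by case: D => D DP; apply/asboolP. Qed.

Lemma commutator_derivation (D E : Der) :
  (fun a => D (E a) - E (D a)) \in derivations.
Proof.
have [Dl DM] := derP D; have [El EM] := derP E.
have DD a b : D (a + b) = D a + D b by rewrite -[a]scale1r Dl !scale1r.
have ED a b : E (a + b) = E a + E b by rewrite -[a]scale1r El !scale1r.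
apply/asboolP; split=> [c a b|a b].
  by rewrite !(Dl, El) scalerBr opprD addrACA.
rewrite !(DM, EM, DD, ED) mulrBl mulrBr !opprD !addrA.
by rewrite [LHS](ACl (1 * 5 * 4 * 8 * (2 * 7) * (3 * 6))) /= !subrr !addr0 -!addrA.
Qed.

Definition der_bracket (D E : Der) : Der := MkDer (commutator_derivation D E).

Lemma der_bracketE (D E : Der) a : der_bracket D E a = D (E a) - E (D a).
Proof. by []. Qed.

Lemma der_eqP (D E : Der) : (forall a, D a = E a) -> D = E.
Proof. by move=> DE; apply/val_inj/funext. Qed.

Lemma der_addE (D E : Der) a : (D + E) a = D a + E a.
Proof. by []. Qed.

Lemma der_scaleE k (D : Der) a : (k *: D) a = k *: D a.
Proof. by []. Qed.

Lemma der_bracket_linearl (E : Der) : linear (der_bracket^~ E).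
Proof.
move=> k D D'; apply: der_eqP => a; have [El _] := derP E.
by rewrite !(der_bracketE, der_addE, der_scaleE) El scalerBr opprD addrACA.
Qed.

Lemma der_bracket_linearr (D : Der) : linear (der_bracket D).
Proof.
move=> k E E'; apply: der_eqP => a; have [Dl _] := derP D.
by rewrite !(der_bracketE, der_addE, der_scaleE) Dl scalerBr opprD addrACA.
Qed.

Lemma der_bracketxx (D : Der) : der_bracket D D = 0.
Proof. by apply: der_eqP => a; rewrite der_bracketE subrr. Qed.

Lemma der_bracket_jacobi (D E G : Der) :
  der_bracket D (der_bracket E G) + der_bracket E (der_bracket G D)
    + der_bracket G (der_bracket D E) = 0.
Proof.
apply: der_eqP => a; rewrite !(der_addE, der_bracketE).
have derB (X : Der) u v : X (u - v) = X u - X v.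
  have [Xl _] := derP X.
  by rewrite addrC -scaleN1r Xl scaleN1r addrC.
rewrite !derB !opprB !addrA [LHS](ACl ((1 * 12) * (7 * 2) * (3 * 10) * (5 * 4)
  * (11 * 6) * (9 * 8))) /=.
by rewrite !subrr !addr0.
Qed.

HB.instance Definition _ := Lmodule_isLie.Build F Der
  der_bracket_linearl der_bracket_linearr der_bracketxx der_bracket_jacobi.

End Derivations.

Definition witt_algebra (F : fieldType) (n : nat) : lieAlgType F :=
  Der {mpoly F[n]}.

(* Main.v *)
Require Import Defs.
From HB Require Import structures.
From mathcomp Require Import all_boot all_order all_algebra.
From mathcomp Require Import mpoly.
From mathcomp Require Import boolp.
From mathcomp Require Import ring.

Set Implicit Arguments.
Unset Strict Implicit.
Unset Printing Implicit Defensive.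

Import Order.TTheory GRing.Theory Num.Theory.
Local Open Scope ring_scope.

(* (i) Every derivation is skew for the Killing form K, so T(x, y, z) = K(x.y, z)
   is symmetric in x, y and skew in y, z; hence T = - T, and x.y = 0 since K is
   non-degenerate and 2 <> 0.

   (ii) Derivations of the Witt algebra W are inner, so x.y = [phi x, y] with
   phi : W -> W a Lie algebra morphism such that [phi x, y] = [phi y, x]. Let E
   be the Euler field. As [phi E, y] = [phi y, E] and ad E is the degree,
   testing against y = d_i and y = t_i^2 d_k kills the constant and linear parts
   of phi E. Then ad (phi E) strictly raises degrees, while
   [phi E, phi d_i] = phi [E, d_i] = - phi d_i, so phi d_i = 0. Consequently
   [phi y, d_i] = [phi d_i, y] = 0, i.e. every phi y is a constant field; this
   forces phi E = 0, and then [phi y, E] = [phi E, y] = 0 gives phi y = 0. *)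

(** * Bracket identities and Lie derivations *)

Definition lie_derivation (F : fieldType) (L : lieAlgType F) (D : L -> L) :=
  linear D /\ forall x y, D \[x, y\] = \[D x, y\] + \[x, D y\].

Section LieAlgebras.
Variables (F : fieldType) (L : lieAlgType F).
Implicit Types x y z : L.

Lemma bracketDl x y z : \[x + y, z\] = \[x, z\] + \[y, z\].
Proof. by have := bracket_linearl z 1 x y; rewrite !scale1r. Qed.

Lemma bracketDr x y z : \[x, y + z\] = \[x, y\] + \[x, z\].
Proof. by have := bracket_linearr x 1 y z; rewrite !scale1r. Qed.

Lemma bracketC x y : \[x, y\] = - \[y, x\].
Proof.
apply/eqP; rewrite -addr_eq0; apply/eqP.
by have := bracketxx (x + y); rewrite bracketDl !bracketDr !bracketxx add0r addr0.
Qed.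

Lemma bracketBl x y z : \[x - y, z\] = \[x, z\] - \[y, z\].
Proof.
by have := bracket_linearl z (-1) y x; rewrite !scaleN1r ![- _ + _]addrC.
Qed.

Lemma bracket0l x : \[0, x\] = 0.
Proof. by have := bracketBl 0 0 x; rewrite !subrr. Qed.

Lemma bracketNl x y : \[- x, y\] = - \[x, y\].
Proof. by rewrite -[- x]add0r bracketBl bracket0l add0r. Qed.

Lemma bracketNr x y : \[x, - y\] = - \[x, y\].
Proof. by rewrite bracketC bracketNl -bracketC. Qed.

Lemma bracketBr x y z : \[x, y - z\] = \[x, y\] - \[x, z\].
Proof. by rewrite bracketDr bracketNr. Qed.

Lemma bracket_derivation x : lie_derivation (bracket x).
Proof.
split=> [|y z]; first exact: bracket_linearr.
have := bracket_jacobi x y z; rewrite [\[z, x\]]bracketC [\[z, \[x, y\]\]]bracketC.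
by rewrite bracketNr -addrA -opprD => /eqP; rewrite subr_eq0 addrC => /eqP.
Qed.

Lemma lie_derivationB (D D' : L -> L) : lie_derivation D -> lie_derivation D' ->
  lie_derivation (fun x => D x - D' x).
Proof.
move=> [Dl DM] [Dl' DM']; split=> [k x y|x y].
  by rewrite Dl Dl' scalerBr opprD addrACA.
by rewrite DM DM' bracketBl bracketBr opprD addrACA.
Qed.

Variables (m : L -> L -> L) (m_cpl : commutative_post_lie m).

Lemma cpl_derivation x : lie_derivation (m x).
Proof. by split; [exact: (cpl_linearr m_cpl)|exact: (cpl_bracketr m_cpl)]. Qed.

End LieAlgebras.

(** * The Killing form and case (i) *)

Section Killing.
Variables (F : fieldType) (L : finLieAlgType F).

Lemma lfun_traceC (f g : 'End(L)) : lfun_trace (f \o g)%VF = lfun_trace (g \o f)%VF.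
Proof.
by rewrite /lfun_trace !(passmx.mxof_comp _ _ (vbasisP _)) mxtrace_mulC.
Qed.

Lemma lfun_traceB (f g : 'End(L)) : lfun_trace (f - g) = lfun_trace f - lfun_trace g.
Proof.
have := passmx.mxof_linear (vbasis {:L}) (vbasis {:L}) (-1) g f.
rewrite !scaleN1r /lfun_trace [f - g]addrC => ->.
by rewrite mxtraceD [\tr (- _)]raddfN addrC.
Qed.

Lemma killing_sym (x y : L) : killing x y = killing y x.
Proof. exact: lfun_traceC. Qed.

(** With [d] the operator of [D], [ad (D z)] is the commutator of [d] and [ad z]. Hence
    [killing (D x) y + killing x (D y)] is the trace of the commutator of [d] with [ad x \o ad y],
    which is 0. *)
Lemma killing_derivation (D : L -> L) x y : lie_derivation D ->
  killing (D x) y = - killing x (D y).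
Proof.
move=> [Dl DM].
pose D' : {linear L -> L} := HB.pack D (GRing.isLinear.Build F L L _ D Dl).
pose d : 'End(L) := linfun D'.
have adD z : ad (D z) = (d \o ad z)%VF - (ad z \o d)%VF.
  apply/lfunP => t; rewrite add_lfunE opp_lfunE !comp_lfunE !adE !lfunE /=.
  by rewrite DM addrK.
rewrite /killing !adD comp_lfunDl comp_lfunDr comp_lfunNl comp_lfunNr.
by rewrite !lfun_traceB !comp_lfunA opprB -[(d \o _ \o _)%VF]comp_lfunA lfun_traceC.
Qed.

End Killing.

Lemma killing_nondegenerate_cpl_eq0 (F : fieldType) (L : finLieAlgType F)
    (m : L -> L -> L) : 2%N \notin [pchar F] -> killing_nondegenerate L ->
  commutative_post_lie m -> forall x y, m x y = 0.
Proof.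
move=> F2 nd mP x y; apply: nd => z.
pose T a b c := killing (m a b) c.
have T12 a b c : T a b c = T b a c by rewrite /T (cplC mP).
have T23 a b c : T a b c = - T a c b.
  by rewrite /T (killing_derivation _ _ (cpl_derivation mP a)) killing_sym.
(* The composite of [T12] and [T23] is a 3-cycle of the arguments and costs one sign; three passes
   return to [T x y z] with sign -1. *)
have /eqP : T x y z = - T x y z.
  by rewrite {1}T12 T23 T12 T23 opprK T12 T23 T12.
rewrite -addr_eq0 -mulr2n -mulr_natl mulf_eq0 => /orP[|/eqP//].
by move: F2; rewrite inE /= => /negPf ->.
Qed.

(** * Polynomial derivations as vector fields *)

Section Witt.
Variables (F : fieldType) (n : nat).
Local Notation P := {mpoly F[n]}.
Local Notation W := (witt_algebra F n).
Implicit Types (D E w x y z : W) (p q : P) (i j c : 'I_n) (m : 'X_{1..n}).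

HB.instance Definition _ (D : Der P) :=
  GRing.isLinear.Build F P P _ D (derP D).1.

Lemma derZ (D : W) k p : D (k *: p) = k *: D p.
Proof. exact: linearZ. Qed.

Lemma der_oppE (D : W) p : (- D) p = - D p.
Proof. by []. Qed.

Lemma der0 (D : W) : D 0 = 0.
Proof. exact: raddf0. Qed.

Lemma der_sum (D : W) (I : Type) (r : seq I) (f : I -> P) :
  D (\sum_(i <- r) f i) = \sum_(i <- r) D (f i).
Proof. exact: raddf_sum. Qed.

Lemma mnmBUK m i : m i != 0%N -> (m - U_(i) + U_(i))%MM = m.
Proof.
move=> mi; apply: submK; apply/mnm_lepP => j; rewrite mnm1E.
by case: eqP => // <-; rewrite lt0n.
Qed.

Lemma ltn_mdegBU m i : m i != 0%N -> (mdeg (m - U_(i)) < mdeg m)%N.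
Proof. by move=> mi; rewrite -[in ltnRHS](mnmBUK mi) mdegD mdeg1 addn1. Qed.

Lemma derM (D : W) p q : D (p * q) = D p * q + p * D q.
Proof. exact: (derP D).2. Qed.

Lemma der1 (D : W) : D 1 = 0.
Proof.
by apply: (addIr (D 1)); rewrite add0r -[in RHS](mulr1 1) derM mul1r mulr1.
Qed.

Lemma witt_bracketE D E p : \[D, E\] p = D (E p) - E (D p).
Proof. by []. Qed.

(** By linearity monomials suffice; the Leibniz rule splits off one variable, so induction on the
    degree applies. *)
Lemma witt_eq D E : (forall i, D 'X_i = E 'X_i) -> D = E.
Proof.
move=> DE; apply: der_eqP => p; rewrite (mpolyE p) !raddf_sum /=.
apply: eq_bigr => m _; rewrite !linearZ /=; congr (_ *: _).
have [k] := ubnP (mdeg m); elim: k m => // k IH m mk.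
have [->|] := eqVneq m 0%MM; first by rewrite mpolyX0 !der1.
rewrite -mdeg_eq0 mdegE sum_nat_eq0 negb_forall => /existsP[i /= mi].
rewrite -(mnmBUK mi) mpolyXD !derM DE IH //.
by rewrite -ltnS (leq_trans _ mk) // ltnS ltn_mdegBU.
Qed.

Lemma vfield_derivation (v : 'I_n -> P) :
  (fun p : P => \sum_i v i * p^`M(i)) \in derivations (A := P).
Proof.
apply/asboolP; split=> [k p q|p q].
  rewrite scaler_sumr -big_split; apply: eq_bigr => i _ /=.
  by rewrite mderivD mderivZ mulrDr scalerAr.
rewrite mulr_suml mulr_sumr -big_split; apply: eq_bigr => i _ /=.
by rewrite mderivM mulrDr !mulrA [_ * p]mulrC.
Qed.

Definition vfield (v : 'I_n -> P) : W := MkDer (vfield_derivation v).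

Lemma vfieldE v p : vfield v p = \sum_i v i * p^`M(i).
Proof. by []. Qed.

Lemma mderivXU i j : ('X_j : P)^`M(i) = (i == j)%:R.
Proof.
rewrite mderivX mnm1E eq_sym; case: eqP => [->|_]; last by rewrite scale0r.
rewrite scale1r (_ : (U_(j) - U_(j))%MM = 0%MM) ?mpolyX0 //.
by apply/mnmP => l; rewrite mnmBE subnn mnm0E.
Qed.

Lemma vfieldX v i : vfield v 'X_i = v i.
Proof.
rewrite vfieldE (bigD1 i) //= mderivXU eqxx mulr1 big1 ?addr0 // => j ji.
by rewrite mderivXU (negPf ji) mulr0.
Qed.

Lemma wittE D p : D p = \sum_i D 'X_i * p^`M(i).
Proof.
by rewrite -vfieldE; congr (der_fun _ p); apply: witt_eq => i; rewrite vfieldX.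
Qed.


(** * Coordinate, Euler and monomial fields *)

Definition dX i : W := vfield (fun j => (i == j)%:R).

Lemma dXE i p : dX i p = p^`M(i).
Proof.
rewrite vfieldE (bigD1 i) //= eqxx mul1r big1 ?addr0 // => j ji.
by rewrite eq_sym (negPf ji) mul0r.
Qed.

Definition euler : W := vfield (fun i => 'X_i).

Lemma eulerX i : euler 'X_i = 'X_i.
Proof. exact: vfieldX. Qed.

Lemma mulX_mderivX i m : 'X_i * ('X_[m] : P)^`M(i) = (m i)%:R *: 'X_[m].
Proof.
rewrite mderivX -scalerAr -mpolyXD; have [->|mi] := eqVneq (m i) 0%N.
  by rewrite !scale0r.
by rewrite addmC mnmBUK.
Qed.

Lemma euler_monomial m : euler 'X_[m] = (mdeg m)%:R *: 'X_[m].
Proof.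
rewrite vfieldE mdegE natr_sum scaler_suml.
by apply: eq_bigr => i _; rewrite mulX_mderivX.
Qed.

Lemma mcoeff_euler p m : (euler p)@_m = (mdeg m)%:R * p@_m.
Proof.
have -> : euler p = \sum_(k <- msupp p) p@_k *: ((mdeg k)%:R *: 'X_[k]).
  rewrite {1}(mpolyE p) der_sum; apply: eq_bigr => k _.
  by rewrite derZ euler_monomial.
rewrite [LHS](raddf_sum (mcoeff m)) [in RHS](mpolyE p) (raddf_sum (mcoeff m)) mulr_sumr.
apply: eq_bigr => k _ /=; rewrite !mcoeffZ mcoeffX.
by have [->|_] := eqVneq k m; rewrite ?mulr1 ?mulr0 // mulrC.
Qed.

Lemma dX_bracketE i D j : \[dX i, D\] 'X_j = (D 'X_j)^`M(i).
Proof.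
rewrite witt_bracketE !dXE mderivXU.
by case: eqP => _ /=; rewrite ?mulr1n ?mulr0n ?der1 ?der0 subr0.
Qed.

Lemma dX_euler i : \[dX i, euler\] = dX i.
Proof. by apply: witt_eq => c; rewrite dX_bracketE eulerX dXE. Qed.

Lemma euler_bracketE D j : \[euler, D\] 'X_j = euler (D 'X_j) - D 'X_j.
Proof. by rewrite witt_bracketE eulerX. Qed.

(** The coefficients of [D] have zero partial derivatives, so [euler] kills them: [D] has weight -1
    under [ad euler]. *)
Lemma dX_centralizer D : (forall i, \[dX i, D\] = 0) -> \[euler, D\] = - D.
Proof.
move=> dD; apply: witt_eq => j; rewrite euler_bracketE vfieldE big1 ?sub0r //.
by move=> i _; rewrite -dX_bracketE dD mulr0.
Qed.

(** The field t^m d_j, an eigenvector of [ad euler] of weight [mdeg m - 1]; these fields span W. *)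
Definition monomial_field m j : W := vfield (fun c => (c == j)%:R *: 'X_[m]).

Lemma witt_span D :
  D = \sum_j \sum_(m <- msupp (D 'X_j)) (D 'X_j)@_m *: monomial_field m j.
Proof.
have sumE (I : Type) (r : seq I) (f : I -> W) p :
    (\sum_(i <- r) f i) p = \sum_(i <- r) f i p.
  by elim/big_rec2: _ => // i y x _ <-.
apply: witt_eq => c; rewrite sumE (bigD1 c) //= [X in _ + X]big1 => [|j jc].
  rewrite addr0 sumE [LHS]mpolyE; apply: eq_bigr => m _.
  by rewrite der_scaleE vfieldX eqxx scale1r.
rewrite sumE big1 // => m _; rewrite der_scaleE vfieldX eq_sym (negPf jc).
by rewrite scale0r scaler0.
Qed.

Lemma dX_monomial i m j :
  \[dX i, monomial_field m j\] = (m i)%:R *: monomial_field (m - U_(i)) j.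
Proof.
apply: witt_eq => c; rewrite dX_bracketE der_scaleE !vfieldX mderivZ mderivX.
by rewrite !scalerA mulrC.
Qed.

Lemma euler_monomial_field m j :
  \[euler, monomial_field m j\] = ((mdeg m)%:R - 1) *: monomial_field m j.
Proof.
apply: witt_eq => c; rewrite euler_bracketE der_scaleE !vfieldX derZ.
by rewrite euler_monomial scalerBl scale1r !scalerA mulrC.
Qed.

(** * Derivations of the Witt algebra in characteristic 0 *)

Hypothesis F0 : [pchar F] =i pred0.

Lemma natf_eq0 k : (k%:R == 0 :> F) = (k == 0%N).
Proof. by have /pcharf0P := F0. Qed.

(** By induction on the degree, [Q (monomial_field m j)] commutes with every [dX i], so its weight
    under [ad euler] is -1. As [Q euler = 0], its weight is also [mdeg m - 1]. Hence it is 0 unless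
    [m] is 0, where the field is [dX j]. *)
Lemma lie_derivation_witt_eq0 (Q : W -> W) : lie_derivation Q ->
  (forall i, Q (dX i) = 0) -> Q euler = 0 -> forall D, Q D = 0.
Proof.
move=> [Ql QM] QdX Qe.
pose Q' : {linear W -> W} := HB.pack Q (GRing.isLinear.Build F W W _ Q Ql).
have QZ k D : Q (k *: D) = k *: Q D by exact: (linearZ_LR Q').
have Q0 m j : Q (monomial_field m j) = 0.
  have [k] := ubnP (mdeg m); elim: k m => // k IH m mk.
  have /dX_centralizer : forall i, \[dX i, Q (monomial_field m j)\] = 0.
    move=> i; have := QM (dX i) (monomial_field m j).
    rewrite QdX bracket0l add0r => <-; rewrite dX_monomial QZ.
    have [->|mi] := eqVneq (m i) 0%N; first by rewrite scale0r.
    by rewrite IH ?scaler0 // -ltnS (leq_trans _ mk) // ltnS ltn_mdegBU.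
  have := QM euler (monomial_field m j).
  rewrite Qe bracket0l add0r => <-; rewrite euler_monomial_field QZ => /eqP.
  rewrite scalerBl scale1r subr_eq addNr scaler_eq0 natf_eq0 mdeg_eq0.
  case/orP => [/eqP -> | /eqP //]; suff -> : monomial_field 0 j = dX j by [].
  apply: witt_eq => c; rewrite !vfieldX mpolyX0 eq_sym.
  by case: eqP; rewrite ?scale1r ?scale0r.
move=> D; rewrite (witt_span D) [LHS](raddf_sum Q') big1 // => j _.
rewrite [LHS](raddf_sum Q') big1 // => m _.
by rewrite [LHS](linearZ_LR Q') /= Q0 scaler0.
Qed.

(* With w the sum of the X_i * u_i, closedness reads (1 + euler) u_j = d_j w, so a
   potential of u is obtained by dividing the degree k part of w by k. *)
Lemma poincare (u : 'I_n -> P) : (forall i j, (u i)^`M(j) = (u j)^`M(i)) ->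
  exists p, forall i, p^`M(i) = u i.
Proof.
move=> uC; pose w := \sum_i 'X_i * u i.
have dw j : w^`M(j) = u j + euler (u j).
  rewrite raddf_sum /= (eq_bigr (fun i => (j == i)%:R * u i + 'X_i * (u j)^`M(i))).
    rewrite big_split /= (bigD1 j) //= eqxx mul1r big1 ?addr0 // => i ij.
    by rewrite eq_sym (negPf ij) mul0r.
  by move=> i _; rewrite mderivM mderivXU uC.
(* At degree 0 the quotient is 0 by the convention on inverses; the derivatives of [p] only see the
   coefficients at [m + U_(i)]. *)
pose p : P := \sum_(m <- msupp w) (w@_m / (mdeg m)%:R) *: 'X_[m].
have pE m : p@_m = w@_m / (mdeg m)%:R.
  rewrite raddf_sum /= [in RHS](mpolyE w) raddf_sum mulr_suml.
  apply: eq_bigr => k _ /=; rewrite !mcoeffZ mcoeffX.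
  by have [->|_] := eqVneq k m; rewrite ?mulr1 // !mulr0 mul0r.
exists p => i; apply/mpolyP => m; rewrite mcoeff_mderiv pE -mulrnAl -mcoeff_mderiv.
rewrite dw mcoeffD mcoeff_euler -[X in X + _]mul1r -mulrDl nat1r.
by rewrite mdegD mdeg1 addn1 mulrC mulKf // natf_eq0.
Qed.

Lemma witt_derivation_inner (Q : W -> W) : lie_derivation Q ->
  exists D, forall E, Q E = \[D, E\].
Proof.
move=> Qder; have [_ QM] := Qder.
have dd i j : \[dX i, dX j\] = 0.
  apply: witt_eq => c; rewrite dX_bracketE dXE mderivXU.
  by case: eqP => _ /=; rewrite ?mulr1n ?mulr0n -?dXE ?der1 ?der0.
have Q0 : Q 0 = 0.
  by have := QM 0 0; rewrite bracketxx bracket0l [\[_, 0\]]bracketC bracket0l oppr0 addr0.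
have uC c i j : (Q (dX i) 'X_c)^`M(j) = (Q (dX j) 'X_c)^`M(i).
  rewrite -!dX_bracketE; have /eqP := QM (dX i) (dX j).
  by rewrite dd Q0 eq_sym addrC [\[Q _, _\]]bracketC subr_eq0 => /eqP <-.
have /choice[p pE] c := poincare (uC c).
(* The sign turns [\[D, dX i\]] into [\[dX i, vfield p\]], whose coefficients are the
   d_i-derivatives of the potentials. *)
pose D := - vfield p.
pose Q1 E := Q E - \[D, E\].
have Q1der : lie_derivation Q1 by apply: lie_derivationB => //; exact: bracket_derivation.
have Q1d i : Q1 (dX i) = 0.
  apply/eqP; rewrite subr_eq0; apply/eqP/witt_eq => c.
  by rewrite /D bracketNl -bracketC dX_bracketE vfieldX pE.
(* Applying [Q1] to [\[dX i, euler\] = dX i] shows that [e] commutes with every [dX i]. So [ad e]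
   kills the [dX i] and sends [euler] to [e], exactly as [Q1] does. *)
pose e := Q1 euler.
have ed i : \[dX i, e\] = 0.
  by have := Q1der.2 (dX i) euler; rewrite dX_euler Q1d bracket0l add0r => <-.
pose Q2 E := Q1 E - \[e, E\].
have Q2der : lie_derivation Q2 by apply: lie_derivationB => //; exact: bracket_derivation.
have Q20 : forall E, Q2 E = 0.
  apply: lie_derivation_witt_eq0 => // [i|].
    by rewrite /Q2 Q1d bracketC ed oppr0 subr0.
  by rewrite /Q2 bracketC dX_centralizer // opprK subrr.
exists (D + e) => E; apply/eqP; rewrite bracketDl -subr_eq0 opprD addrA.
by apply/eqP; exact: Q20.
Qed.

(** The bracket of [euler] and [D] is both [- D] and 0. In particular W has trivial centre. *)
Lemma witt_centralizer_eq0 D : (forall i, \[dX i, D\] = 0) -> \[euler, D\] = 0 ->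
  D = 0.
Proof. by move=> /dX_centralizer-> /eqP; rewrite oppr_eq0 => /eqP. Qed.

(** * Order of vanishing at the origin *)

(** Membership in the k-th power of the ideal generated by the variables. *)
Definition order_ge k p := forall m, (mdeg m < k)%N -> p@_m = 0.

Lemma order_geM k l p q : order_ge k p -> order_ge l q -> order_ge (k + l) (p * q).
Proof.
move=> pk ql m; rewrite mcoeffM => mkl; apply: big1 => -[a b] /= /eqP mE.
have [/pk ->|ka] := ltnP (mdeg a) k; first by rewrite mul0r.
rewrite ql ?mulr0 // -(ltn_add2l k); apply: leq_ltn_trans mkl.
by rewrite [leqRHS](etrans (congr1 (@mdeg n) mE) (mdegD _ _)) leq_add2r.
Qed.

Lemma order_ge_deriv i k p : order_ge k p -> order_ge k.-1 p^`M(i).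
Proof.
move=> pk m mk; rewrite mcoeff_mderiv pk ?mul0rn //.
by rewrite mdegD mdeg1 addn1; case: k mk {pk}.
Qed.

Lemma order_ge_der (D : W) k l p : (forall i, order_ge k (D 'X_i)) ->
  order_ge l p -> order_ge (k + l.-1) (D p).
Proof.
move=> Dk pl m mkl; rewrite wittE raddf_sum big1 // => i _ /=.
by apply: order_geM mkl => //; apply: order_ge_deriv.
Qed.

(** Bracketing with [D] raises the order of vanishing, whereas [- E] has the order of [E]; so [E]
    vanishes to every order. *)
Lemma order2_fixpoint_eq0 D E : (forall i, order_ge 2 (D 'X_i)) ->
  \[D, E\] = - E -> E = 0.
Proof.
move=> D2 DE; have E_order k : forall i, order_ge k (E 'X_i).
  elim: k => [//|k IH] i m mk.
  have /(congr1 (mcoeff m)) : E (D 'X_i) - D (E 'X_i) = E 'X_i.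
    by rewrite -opprB -witt_bracketE DE der_oppE opprK.
  rewrite mcoeffB => <-.
  rewrite (@order_ge_der E k 2) ?addn1 // (@order_ge_der D 2 k) ?subrr //.
  (* For [k = 0] the truncated predecessor gives order 2, above the required 1; otherwise the order
     is exactly [k.+1]. *)
  by apply: leq_trans mk _; case: (k).
apply: witt_eq => i; apply/mpolyP => m; rewrite mcoeff0.
exact: (E_order (mdeg m).+1 i m).
Qed.


(** * Coefficients of brackets with test fields *)

Lemma monomial_fieldE m j p : monomial_field m j p = 'X_[m] * p^`M(j).
Proof.
rewrite vfieldE (bigD1 j) //= eqxx scale1r big1 ?addr0 // => i ij.
by rewrite (negPf ij) scale0r mul0r.
Qed.

Lemma square_bracketE D i k c : \[D, monomial_field (U_(i) + U_(i)) k\] 'X_c =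
  (c == k)%:R *: ('X_i * D 'X_i *+ 2) - 'X_i * 'X_i * (D 'X_c)^`M(k).
Proof.
rewrite witt_bracketE vfieldX monomial_fieldE derZ mpolyXD derM.
by rewrite [D _ * _]mulrC mulr2n.
Qed.

Lemma mcoeff_mulX p i m : ('X_i * p)@_(U_(i) + m) = p@_m.
Proof. by rewrite mulrC mcoeffMX. Qed.

(** The other term of the bracket has order at least 2, so this coefficient isolates the constant
    part of [D]. *)
Lemma square_bracket_coef1 D i k c :
  (\[D, monomial_field (U_(i) + U_(i)) k\] 'X_c)@_U_(i) =
  (c == k)%:R * ((D 'X_i)@_0 *+ 2).
Proof.
rewrite square_bracketE mcoeffB mcoeffZ mcoeffMn -{1}[U_(i)%MM]addm0 mcoeff_mulX.
have X1 : order_ge 1 'X_i.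
  by move=> m; rewrite ltnS leqn0 mdeg_eq0 mcoeffX => /eqP ->; rewrite mnm1_eq0.
have X2 : order_ge 2 ('X_i * 'X_i * (D 'X_c)^`M(k)).
  by apply: (order_geM (k := 2) (l := 0)) => //; apply: (order_geM X1 X1).
by rewrite X2 ?mdeg1 // subr0.
Qed.

(** Cancelling the factors ['X_i] leaves linear coefficients of [D], so this coefficient probes its
    linear part. *)
Lemma square_bracket_coef2 D i k c :
  (\[D, monomial_field (U_(i) + U_(i)) k\] 'X_c)@_(U_(i) + U_(i)) =
  (c == k)%:R * ((D 'X_i)@_U_(i) *+ 2) - (D 'X_c)@_U_(k).
Proof.
rewrite square_bracketE mcoeffB mcoeffZ mcoeffMn mcoeff_mulX -mulrA.
rewrite -[X in (_ * (_ * _))@_(_ + X)]addm0 !mcoeff_mulX mcoeff_mderiv.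
by rewrite mnm0E add0m.
Qed.

Lemma bracket_dX_coef D i c m :
  (\[D, dX i\] 'X_c)@_m = - ((D 'X_c)@_(m + U_(i)) *+ (m i).+1).
Proof. by rewrite bracketC der_oppE dX_bracketE mcoeffN mcoeff_mderiv. Qed.

Lemma bracket_euler_coef D c m :
  (\[D, euler\] 'X_c)@_m = (1 - (mdeg m)%:R) * (D 'X_c)@_m.
Proof.
by rewrite bracketC der_oppE euler_bracketE opprB mcoeffB mcoeff_euler mulrBl mul1r.
Qed.

(** * Commutative post-Lie structures on the Witt algebra *)

Lemma witt_cpl_eq0 (mu : W -> W -> W) : commutative_post_lie mu ->
  forall x y, mu x y = 0.
Proof.
move=> muP.
have /choice[phi phiE] x := witt_derivation_inner (cpl_derivation muP x).
have phiC x y : \[phi x, y\] = \[phi y, x\] by rewrite -!phiE (cplC muP).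
have phiM x y : phi \[x, y\] = \[phi x, phi y\].
  (* The post-Lie identity makes both sides of the morphism law act alike on W, so their difference
     is central. *)
  have phiMz z : \[z, phi \[x, y\] - \[phi x, phi y\]\] = 0.
    rewrite bracketC bracketBl -phiE (cpl_bracketl muP) !phiE.
    by rewrite (bracket_derivation (phi x)).2 addrK subrr oppr0.
  by apply/eqP; rewrite -subr_eq0; apply/eqP/witt_centralizer_eq0.
pose u := phi euler.
have uE y c m : (\[u, y\] 'X_c)@_m = (1 - (mdeg m)%:R) * (phi y 'X_c)@_m.
  by rewrite phiC bracket_euler_coef.
have two0 : 2 != 0 :> F by rewrite natf_eq0.
have u0 c : (u 'X_c)@_0 = 0.
  (* In degree 1 the factor [1 - mdeg m] of [uE] vanishes. *)
  have := uE (monomial_field (U_(c) + U_(c)) c) c U_(c)%MM.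
  rewrite square_bracket_coef1 eqxx mul1r mdeg1 subrr mul0r -mulr_natl => /eqP.
  by rewrite mulf_eq0 (negPf two0) => /eqP.
pose A c k := (u 'X_c)@_U_(k).
(* Let [t] be the coefficient of t_i^2 in [phi (t_i^2 d_k) 'X_c] and [d] the Kronecker symbol of [c]
   and [k]. Then [E1] gives [t = A c k - 2 * d * A i i], while [E2] with [E3] gives
   [2 * t = 2 * d * A i i]. *)
have A3 i c k : A c k = 3 * (c == k)%:R * A i i.
  have E1 := uE (monomial_field (U_(i) + U_(i)) k) c (U_(i) + U_(i))%MM.
  have E2 : (\[phi (dX i), monomial_field (U_(i) + U_(i)) k\] 'X_c)@_U_(i) =
            (\[phi (monomial_field (U_(i) + U_(i)) k), dX i\] 'X_c)@_U_(i).
    by rewrite phiC.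
  have E3 := uE (dX i) i 0%MM.
  rewrite square_bracket_coef2 mdegD mdeg1 -/(A i i) -/(A c k) in E1.
  rewrite square_bracket_coef1 bracket_dX_coef mnm1E eqxx in E2.
  rewrite bracket_dX_coef mnm0E add0m mdeg0 subr0 mul1r -/(A i i) in E3.
  rewrite -E3 in E2; apply: (mulfI two0).
  move: E1 E2; set t := (_ 'X_c)@_(_ + _); set d := (c == k)%:R => E1 E2.
  have -> : 2 * A c k = 2 * (d * (A i i *+ 2) - (d * (A i i *+ 2) - A c k)) by ring.
  rewrite E1.
  have -> : 2 * (d * (A i i *+ 2) - (1 - (1 + 1)%:R) * t) =
            4 * d * A i i - t *- true.+1 by rewrite /=; ring.
  by rewrite -E2; ring.
have A0 c k : A c k = 0.
  (* With all three indices equal, [A3] reads [A k k = 3 * A k k]. *)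
  have Akk : A k k = 0.
    have /eqP := A3 k k k; rewrite eqxx mulr1 -subr_eq0.
    have -> : A k k - 3 * A k k = - (2 * A k k) by ring.
    by rewrite oppr_eq0 mulf_eq0 (negPf two0) => /eqP.
  by rewrite (A3 k) Akk mulr0.
have u2 c : order_ge 2 (u 'X_c).
  move=> m; rewrite ltnS leq_eqVlt => /orP[/mdeg1P[k /eqP ->]|]; first exact: A0.
  by rewrite ltnS leqn0 mdeg_eq0 => /eqP ->.
have phid i : phi (dX i) = 0.
  apply: (order2_fixpoint_eq0 u2); rewrite bracketC -phiM.
  by rewrite dX_euler.
have dphi y i : \[dX i, phi y\] = 0.
  by rewrite bracketC phiC phid bracket0l oppr0.
have uz : u = 0.
  apply: witt_eq => c; apply/mpolyP => m; rewrite mcoeff0.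
  (* Commuting with every [dX i] multiplies each coefficient by [mdeg m] to 0, so only constant
     coefficients could survive; [u2] excludes them. *)
  have /(congr1 (fun D : W => (D 'X_c)@_m)) := dX_centralizer (dphi euler).
  rewrite euler_bracketE der_oppE mcoeffB mcoeffN mcoeff_euler => /eqP.
  rewrite subr_eq addNr mulf_eq0 natf_eq0 => /orP[/eqP m0|/eqP//].
  by apply: u2; rewrite m0.
have phi0 y : phi y = 0.
  apply: witt_centralizer_eq0; first exact: dphi.
  by rewrite bracketC phiC -/u uz bracket0l oppr0.
by move=> x y; rewrite phiE phi0 bracket0l.
Qed.

End Witt.

Theorem theorem5p3 (F : fieldType) :
  (forall L : finLieAlgType F,
     2%N \notin [pchar F] -> 3%N \notin [pchar F] ->
     classical_simple L -> killing_nondegenerate L ->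
     forall m : L -> L -> L, commutative_post_lie m ->
     forall x y : L, m x y = 0)
  /\
  (forall n : nat, (1 <= n)%N -> [pchar F] =i pred0 ->
     forall m : witt_algebra F n -> witt_algebra F n -> witt_algebra F n,
     commutative_post_lie m ->
     forall x y : witt_algebra F n, m x y = 0).
Proof.
split=> [L F2 _ _ nd m mP x y|n _ F0 m mP x y].
  exact: killing_nondegenerate_cpl_eq0.
exact: witt_cpl_eq0.
Qed.
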